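(* $(\mathbb{H}^n,d)$ has finite intersection dimension with respect to itself: there exist $\kappa\in\mathbb{N}$ and $R>1$ such that whenever $t(1),\dots,t(\kappa)\ge1$, $r(1),\dots,r(\kappa)$ satisfy $r(i)\ge t(1)\cdots t(i)R$ for each $i$, and $x_1,\dots,x_\kappa\in\mathbb{H}^n$ satisfy $x_i\in\bigcap_{j<i}\partial_{t(j)}B_{r(j)}(x_j)$ for all $i\le\kappa$, we have $\bigcap_{i=1}^\kappa\partial_{t(i)}B_{r(i)}(x_i)=\emptyset$.
   Context: $\mathbb{H}^n=\mathbb{C}^n\times\mathbb{R}$ with product $(z,\tau)(w,\sigma)=(z+w,\tau+\sigma+\tfrac12\operatorname{Im}\langle z,w\rangle)$, $\langle z,w\rangle=\sum_j\overline{z_j}w_j$; dilations $\delta_\lambda(z,\tau)=(\lambda z,\lambda^2\tau)$; $d(p,q)=\inf\{r>0:\delta_{1/r}(pq^{-1})\in B_{eucl}\}$ with $B_{eucl}$ the closed Euclidean unit ball in $\mathbb{R}^{2n+1}$. $B_r(p)=\{y:d(y,p)\le r\}$, $\partial B_r(p)=\{y:d(y,p)=r\}$, and $\partial_tB_r(p)=\{y\in\mathbb{H}^n:d(y,\partial B_r(p))\le t\}$. *)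

(* Defs.v *)
From Stdlib Require Import Reals Lra ClassicalEpsilon.
Open Scope R_scope.

Fixpoint rsum (n : nat) (f : nat -> R) : R :=
  match n with O => 0 | S k => rsum k f + f k end.

Fixpoint rprod1 (i : nat) (f : nat -> R) : R :=
  match i with O => 1 | S k => rprod1 k f * f (S k) end.

(* Raw points of C^n x R: z_j = za j + i * zb j, last coordinate tau. *)
Record point := mkpoint { za : nat -> R; zb : nat -> R; tau : R }.

Definition Hn (n : nat) : Type :=
  { p : point | forall j, (n <= j)%nat -> za p j = 0 /\ zb p j = 0 }.

(* Im <z,w> with <z,w> = sum_j conj(z_j) w_j. *)
Definition im_inner (n : nat) (p q : point) : R :=
  rsum n (fun j => za p j * zb q j - zb p j * za q j).

Definition hmul (n : nat) (p q : point) : point :=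
  mkpoint (fun j => za p j + za q j) (fun j => zb p j + zb q j)
          (tau p + tau q + / 2 * im_inner n p q).

Definition hinv (p : point) : point :=
  mkpoint (fun j => - za p j) (fun j => - zb p j) (- tau p).

Definition dil (lam : R) (p : point) : point :=
  mkpoint (fun j => lam * za p j) (fun j => lam * zb p j) (lam ^ 2 * tau p).

Definition in_eucl_ball (n : nat) (p : point) : Prop :=
  rsum n (fun j => za p j ^ 2 + zb p j ^ 2) + tau p ^ 2 <= 1.

Definition is_glb (S : R -> Prop) (m : R) : Prop :=
  (forall x, S x -> m <= x) /\ (forall b, (forall x, S x -> b <= x) -> b <= m).

(* infimum of a set of reals (a glb, chosen by epsilon; junk if none exists) *)
Definition Rinf (S : R -> Prop) : R :=
  epsilon (inhabits 0) (fun m => is_glb S m).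

Definition hdist_raw (n : nat) (p q : point) : R :=
  Rinf (fun r => 0 < r /\ in_eucl_ball n (dil (/ r) (hmul n p (hinv q)))).

Definition hd (n : nat) (x y : Hn n) : R := hdist_raw n (proj1_sig x) (proj1_sig y).

Definition sphere (n : nat) (r : R) (p : Hn n) : Hn n -> Prop :=
  fun y => hd n y p = r.

Definition dist_to_set (n : nat) (y : Hn n) (A : Hn n -> Prop) : R :=
  Rinf (fun s => exists q, A q /\ s = hd n y q).

Definition thick_sphere (n : nat) (t r : R) (p : Hn n) : Hn n -> Prop :=
  fun y => dist_to_set n y (sphere n r p) <= t.

(* Main.v *)
(** Translate so that [y] is the identity. For [j < i] both [y] and [x_i] can be moved by at most
    [2 t(j)], which is tiny compared with [r(i)] and [r(j)], onto the sphere of radius [r(j)]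
    about [x_j]. Subtracting the equations of these two points gives an exact identity
    between [x_j] and [x_i], rescaled by [r(j)] and [r(i)]. By the pigeonhole principle we may
    assume that the rescaled points and the directions of their horizontal parts [z_i] nearly
    agree, and that [r(i) <= 1.1 r(j)]. The identity then puts both points near the vertical
    axis, and there forces [|z_i| <= 12 t(j)] and [r(i)^2 <= 24 |z_j| t(j)]. For three indices
    [a < b < c] this yields [r(c)^2 <= 288 t(a) t(b) <= 288 r(c) / R], which is absurd for
    large [R]. *)

From Stdlib Require Import Reals Lra Lia Arith List Sorted ClassicalEpsilon FunctionalExtensionality.
Require Import Defs.
Open Scope R_scope.

(** * Absolute values and finite sums *)

Lemma Rabs_le_inv (x c : R) : Rabs x <= c -> - c <= x <= c.
Proof. unfold Rabs. destruct (Rcase_abs x); lra. Qed.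

Lemma rsum_ext (n : nat) (f g : nat -> R) :
  (forall j, (j < n)%nat -> f j = g j) -> rsum n f = rsum n g.
Proof.
  induction n as [|n IH]; intros H; simpl; [reflexivity|].
  rewrite IH, (H n) by (intros; try apply H; lia). reflexivity.
Qed.

Lemma rsum_lin (n : nat) (a b : R) (f g : nat -> R) :
  rsum n (fun j => a * f j + b * g j) = a * rsum n f + b * rsum n g.
Proof. induction n as [|n IH]; simpl; [ring|rewrite IH; ring]. Qed.

Lemma rsum_nonneg (n : nat) (f : nat -> R) :
  (forall j, (j < n)%nat -> 0 <= f j) -> 0 <= rsum n f.
Proof.
  induction n as [|n IH]; intros H; simpl; [lra|].
  apply Rplus_le_le_0_compat; [apply IH; intros; apply H; lia | apply H; lia].
Qed.

Lemma rsum_le_const (n : nat) (f : nat -> R) (c : R) :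
  (forall j, (j < n)%nat -> f j <= c) -> rsum n f <= INR n * c.
Proof.
  induction n as [|n IH]; intros H; [simpl; lra|].
  rewrite S_INR. simpl rsum.
  assert (rsum n f <= INR n * c) by (apply IH; intros; apply H; lia).
  assert (f n <= c) by (apply H; lia). lra.
Qed.

(** * The horizontal Hermitian form *)

(** This is the real part of the Hermitian form. Like [im_inner] it ignores the height, so under
    both forms [hmul], [dil] and [hinv] behave as addition, scaling and negation of horizontal
    vectors. *)
Definition re_inner (n : nat) (p q : point) : R :=
  rsum n (fun j => za p j * za q j + zb p j * zb q j).

Definition hnorm (n : nat) (p : point) : R := sqrt (re_inner n p p).

Section Forms.
Variable n : nat.
Notation re := (re_inner n).
Notation im := (im_inner n).
Notation nm := (hnorm n).
Notation mul := (hmul n).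

Lemma re_sym p q : re p q = re q p.
Proof. apply rsum_ext; intros; ring. Qed.

Lemma im_antisym p q : im p q = - im q p.
Proof.
  transitivity (rsum n (fun j => (-1) * (za q j * zb p j - zb q j * za p j) + 0 * 0)).
  - apply rsum_ext; intros; ring.
  - rewrite rsum_lin with (g := fun _ => 0). unfold im_inner. ring.
Qed.

Lemma im_self p : im p p = 0.
Proof. pose proof (im_antisym p p). lra. Qed.

Lemma re_mul_l p q w : re (mul p q) w = re p w + re q w.
Proof.
  transitivity (1 * re p w + 1 * re q w); [|ring].
  unfold re_inner. rewrite <- rsum_lin. apply rsum_ext; intros; simpl; ring.
Qed.

Lemma im_mul_l p q w : im (mul p q) w = im p w + im q w.
Proof.
  transitivity (1 * im p w + 1 * im q w); [|ring].
  unfold im_inner. rewrite <- rsum_lin. apply rsum_ext; intros; simpl; ring.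
Qed.

Lemma re_dil_l a p w : re (dil a p) w = a * re p w.
Proof.
  transitivity (a * re p w + 0 * re p w); [|ring].
  unfold re_inner. rewrite <- rsum_lin. apply rsum_ext; intros; simpl; ring.
Qed.

Lemma im_dil_l a p w : im (dil a p) w = a * im p w.
Proof.
  transitivity (a * im p w + 0 * im p w); [|ring].
  unfold im_inner. rewrite <- rsum_lin. apply rsum_ext; intros; simpl; ring.
Qed.

Lemma re_inv_l p w : re (hinv p) w = - re p w.
Proof.
  transitivity ((-1) * re p w + 0 * re p w); [|ring].
  unfold re_inner. rewrite <- rsum_lin. apply rsum_ext; intros; simpl; ring.
Qed.

Lemma im_inv_l p w : im (hinv p) w = - im p w.
Proof.
  transitivity ((-1) * im p w + 0 * im p w); [|ring].
  unfold im_inner. rewrite <- rsum_lin. apply rsum_ext; intros; simpl; ring.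
Qed.

Lemma re_mul_r p q w : re w (mul p q) = re w p + re w q.
Proof. rewrite !(re_sym w). apply re_mul_l. Qed.
Lemma im_mul_r p q w : im w (mul p q) = im w p + im w q.
Proof. rewrite !(im_antisym w), im_mul_l. ring. Qed.
Lemma re_dil_r a p w : re w (dil a p) = a * re w p.
Proof. rewrite !(re_sym w). apply re_dil_l. Qed.
Lemma im_dil_r a p w : im w (dil a p) = a * im w p.
Proof. rewrite !(im_antisym w), im_dil_l. ring. Qed.
Lemma re_inv_r p w : re w (hinv p) = - re w p.
Proof. rewrite !(re_sym w). apply re_inv_l. Qed.
Lemma im_inv_r p w : im w (hinv p) = - im w p.
Proof. rewrite !(im_antisym w), im_inv_l. ring. Qed.

Lemma re_self_nonneg p : 0 <= re p p.
Proof. apply rsum_nonneg; intros; nra. Qed.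

Lemma hnorm_nonneg p : 0 <= nm p.
Proof. apply sqrt_pos. Qed.

Lemma hnorm_sq p : re p p = nm p * nm p.
Proof. symmetry. apply sqrt_sqrt, re_self_nonneg. Qed.

Lemma hnorm_le p c : 0 <= c -> re p p <= c * c -> nm p <= c.
Proof.
  intros Hc H. rewrite <- (sqrt_square c Hc). now apply sqrt_le_1_alt.
Qed.

(** Cauchy-Schwarz, from positivity of the form at the vector |q|^2 p - Re<p,q> q. This vector
    carries no information when |q| = 0, which is treated separately. *)
Lemma re_le p q : re p q <= nm p * nm q.
Proof.
  pose proof (hnorm_nonneg p) as Hp. pose proof (hnorm_nonneg q) as Hq.
  assert (Hpq : 0 <= nm p * nm q) by (apply Rmult_le_pos; assumption).
  apply Rsqr_incr_0_var; [|assumption]. unfold Rsqr.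
  pose proof (re_self_nonneg (mul (dil (re q q) p) (hinv (dil (re p q) q)))) as H.
  rewrite !re_mul_l, !re_mul_r, !re_inv_l, !re_inv_r, !re_dil_l, !re_dil_r in H.
  rewrite (re_sym q p), (hnorm_sq p), (hnorm_sq q) in H.
  destruct (Req_dec (nm q) 0) as [E|E].
  - destruct (Req_dec (re p q) 0) as [E'|E']; [rewrite E', E; lra|exfalso].
    (* With |q| = 0 the form at p - c q equals |p|^2 - 2 c Re<p,q>; this choice of c makes it -|p|^2
       - 2. *)
    pose proof (re_self_nonneg (mul p (hinv (dil ((nm p * nm p + 1) / re p q) q)))) as H1.
    rewrite !re_mul_l, !re_mul_r, !re_inv_l, !re_inv_r, !re_dil_l, !re_dil_r in H1.
    rewrite (re_sym q p), (hnorm_sq p), (hnorm_sq q), E in H1.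
    replace ((nm p * nm p + 1) / re p q * re p q) with (nm p * nm p + 1) in H1 by (field; lra).
    nra.
  - assert (0 < nm q * nm q) by nra. nra.
Qed.

Lemma re_abs_le p q : Rabs (re p q) <= nm p * nm q.
Proof.
  apply Rabs_le. split; [|apply re_le].
  pose proof (re_le (hinv p) q) as H. unfold hnorm in *.
  rewrite !re_inv_l, re_inv_r, Ropp_involutive in H. lra.
Qed.

(** Multiplication by -i, which turns the imaginary part of the form into the real part, so that one
    Cauchy-Schwarz bound gives the other. *)
Definition rot (q : point) : point := mkpoint (zb q) (fun j => - za q j) 0.

Lemma im_abs_le p q : Rabs (im p q) <= nm p * nm q.
Proof.
  replace (im p q) with (re p (rot q)) by (apply rsum_ext; intros; simpl; ring).
  replace (nm q) with (nm (rot q)); [apply re_abs_le|].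
  unfold hnorm; f_equal. apply rsum_ext; intros; simpl; ring.
Qed.

Lemma hnorm_mul p q : nm (mul p q) <= nm p + nm q.
Proof.
  pose proof (hnorm_nonneg p). pose proof (hnorm_nonneg q). pose proof (re_le p q).
  apply hnorm_le; [lra|].
  rewrite re_mul_l, !re_mul_r, (re_sym q p), !hnorm_sq. nra.
Qed.

Lemma hnorm_inv p : nm (hinv p) = nm p.
Proof. unfold hnorm. rewrite re_inv_l, re_inv_r. f_equal. ring. Qed.

Lemma hnorm_dil a p : 0 <= a -> nm (dil a p) = a * nm p.
Proof.
  intros Ha. unfold hnorm. rewrite re_dil_l, re_dil_r, <- Rmult_assoc.
  rewrite sqrt_mult, sqrt_square by (try apply re_self_nonneg; nra). reflexivity.
Qed.

Lemma point_ext p q :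
  (forall j, za p j = za q j) -> (forall j, zb p j = zb q j) -> tau p = tau q -> p = q.
Proof.
  destruct p, q; simpl; intros H1 H2 H3.
  apply functional_extensionality in H1, H2. now subst.
Qed.

(** Right translations cancel; as the distance depends only on p q^-1, this is its right
    invariance. *)
Lemma hmul_cancel a b c : mul (mul a (hinv b)) (hinv (mul c (hinv b))) = mul a (hinv c).
Proof.
  apply point_ext; intros; simpl; try ring.
  rewrite ?im_inv_r, ?im_mul_l, ?im_mul_r, ?im_inv_l, ?im_inv_r, im_self, (im_antisym b c). ring.
Qed.

Lemma hinv_mul_inv a b : hinv (mul a (hinv b)) = mul b (hinv a).
Proof.
  apply point_ext; intros; simpl; try ring.
  rewrite ?im_inv_r, (im_antisym a b). ring.
Qed.

Lemma hmul_inv_mul a b : mul (mul a (hinv b)) b = a.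
Proof.
  apply point_ext; intros; simpl; try ring.
  rewrite ?im_mul_l, ?im_inv_l, ?im_inv_r, im_self. ring.
Qed.

(** * The distance and its spheres *)

(* The inequality follows from the equation except when [r = 0]. *)
Definition on_sphere (r : R) (g : point) : Prop :=
  re g g <= r * r /\ re g g * r ^ 2 + tau g ^ 2 = r ^ 4.

(** A crude substitute for the ball of radius [t], which it contains; corrections of size [t] enter
    the estimates only through these two bounds. *)
Definition in_box (t : R) (g : point) : Prop := nm g <= t /\ Rabs (tau g) <= t ^ 2.

Lemma on_sphere_inv r g : on_sphere r g -> on_sphere r (hinv g).
Proof. unfold on_sphere. rewrite re_inv_l, re_inv_r. simpl tau.
  intros [H1 H2]; split; [lra|rewrite <- H2; ring].
Qed.

Lemma in_box_inv t g : in_box t g -> in_box t (hinv g).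
Proof. unfold in_box. rewrite hnorm_inv. simpl. now rewrite Rabs_Ropp. Qed.

Lemma on_sphere_box r g : 0 <= r -> on_sphere r g -> in_box r g.
Proof.
  unfold on_sphere; intros Hr [H1 H]. pose proof (re_self_nonneg g) as H0.
  split; [now apply hnorm_le|].
  apply Rsqr_incr_0; [|apply Rabs_pos|nra].
  rewrite <- Rsqr_abs. unfold Rsqr.
  assert (0 <= re g g * r ^ 2) by (apply Rmult_le_pos; nra). nra.
Qed.

(** * Infima, and the distance as the root of an equation *)

Lemma is_glb_unique S a b : is_glb S a -> is_glb S b -> a = b.
Proof.
  intros [H1 H2] [H3 H4]. apply Rle_antisym; auto.
Qed.

Lemma Rinf_eq S m : is_glb S m -> Rinf S = m.
Proof.
  intros H. apply (is_glb_unique S); [|assumption].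
  unfold Rinf. apply epsilon_spec. now exists m.
Qed.

Lemma is_glb_Rinf S b : (exists x, S x) -> (forall x, S x -> b <= x) -> is_glb S (Rinf S).
Proof.
  intros [x0 Hx0] Hb. unfold Rinf. apply epsilon_spec.
  (* Completeness yields suprema, so it is applied to the reflected set. *)
  destruct (completeness (fun x => S (- x))) as [m [Hm1 Hm2]].
  - exists (- b). intros x Hx. specialize (Hb _ Hx). lra.
  - exists (- x0). now rewrite Ropp_involutive.
  - exists (- m). split.
    + intros x Hx. assert (- x <= m); [|lra]. apply Hm1. now rewrite Ropp_involutive.
    + intros c Hc. specialize (Hm2 (- c)).
      assert (m <= - c); [|lra]. apply Hm2. intros x Hx. specialize (Hc _ Hx). lra.
Qed.

Lemma in_eucl_ball_dil g r : 0 < r ->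
  in_eucl_ball n (dil (/ r) g) <-> re g g * r ^ 2 + tau g ^ 2 <= r ^ 4.
Proof.
  intros Hr. unfold in_eucl_ball.
  replace (rsum n _) with (re (dil (/ r) g) (dil (/ r) g)) by (apply rsum_ext; intros; ring).
  rewrite re_dil_l, re_dil_r.
  change (tau (dil (/ r) g)) with ((/ r) ^ 2 * tau g).
  assert (0 < r ^ 4) by (apply pow_lt; lra).
  replace (/ r * (/ r * re g g) + ((/ r) ^ 2 * tau g) ^ 2)
    with ((re g g * r ^ 2 + tau g ^ 2) / r ^ 4) by (field; lra).
  set (N := re g g * r ^ 2 + tau g ^ 2). set (M := r ^ 4) in *.
  assert (E : N / M * M = N) by (field; lra).
  split; intros H0; [apply (Rmult_le_compat_r M) in H0|apply (Rmult_le_reg_r M)]; lra.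
Qed.

(* The radius is the positive root of X^2 = |z|^2 X + tau^2, with X = r^2. *)
Lemma hdist_raw_spec p q :
  0 <= hdist_raw n p q /\ on_sphere (hdist_raw n p q) (mul p (hinv q)).
Proof.
  unfold on_sphere. unfold hdist_raw. set (g := mul p (hinv q)).
  pose proof (re_self_nonneg g) as HA. set (A := re g g) in *.
  set (D := sqrt (A * A + 4 * (tau g * tau g))).
  assert (HD : D * D = A * A + 4 * (tau g * tau g)) by (apply sqrt_sqrt; nra).
  assert (HDA : A <= D).
  { apply Rsqr_incr_0; [unfold Rsqr; nra|assumption|apply sqrt_pos]. }
  set (X := (A + D) / 2).
  assert (HX : X * X = A * X + tau g * tau g) by (unfold X; nra).
  assert (HXA : A <= X) by (unfold X; lra).
  set (m := sqrt X).
  assert (Hm0 : 0 <= m) by apply sqrt_pos.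
  assert (Hm : m * m = X) by (apply sqrt_sqrt; lra).
  (* As [X] is a root, A r^2 + tau^2 <= r^4 amounts to (r^2 - X) (r^2 + X - A) >= 0, and A <= X. *)
  assert (Hmem : forall r, 0 < r -> (in_eucl_ball n (dil (/ r) g) <-> m <= r)).
  { intros r Hr. rewrite in_eucl_ball_dil by assumption. fold A. split; intros H.
    - apply Rsqr_incr_0; [|assumption|lra]. unfold Rsqr. rewrite Hm.
      destruct (Rle_lt_dec X (r * r)) as [|C]; [assumption|exfalso].
      assert (0 < r * r) by nra.
      assert (0 < (X - r * r) * (r * r + X - A)) by (apply Rmult_lt_0_compat; lra).
      nra.
    - assert (X <= r * r) by nra.
      assert (0 <= (r * r - X) * (r * r + X - A)) by (apply Rmult_le_pos; nra).
      nra. }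
  rewrite (Rinf_eq _ m).
  - split; [assumption|]. split; [lra|].
    replace (m ^ 4) with (X * X) by (rewrite <- Hm; ring).
    replace (m ^ 2) with X by (rewrite <- Hm; ring). lra.
  - split.
    + intros r [Hr H]. now apply Hmem.
    + intros b Hb. apply Rnot_lt_le. intros C.
      (* [m] may be [0] and then is not in the set, whereas the midpoint is positive and is. *)
      specialize (Hb ((m + b) / 2)). assert (b <= (m + b) / 2); [|lra].
      apply Hb. split; [lra|]. apply Hmem; lra.
Qed.

(** The difference of the two equations factors. If r^2 + s^2 = |z|^2, the inequalities in
    [on_sphere] force both radii to be [0]. *)
Lemma on_sphere_unique r s g : 0 <= r -> 0 <= s -> on_sphere r g -> on_sphere s g -> r = s.
Proof.
  unfold on_sphere. intros Hr Hs [Hrr H1] [Hss H2]. pose proof (re_self_nonneg g) as HA.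
  assert (E : (r * r - s * s) * (r * r + s * s - re g g) = 0) by nra.
  apply Rmult_integral in E.
  assert (r * r = s * s) by (destruct E; nra).
  apply Rsqr_inj; assumption.
Qed.

(** Nonemptiness makes the distance to a sphere a genuine infimum. The witness lies above [p] at
    relative height [r ^ 2]. *)
Lemma sphere_inhabited r (p : Hn n) : 0 < r -> exists q, sphere n r p q.
Proof.
  intros Hr. destruct p as [p Hp].
  assert (Hq : forall j, (n <= j)%nat ->
    za (mkpoint (za p) (zb p) (tau p + r ^ 2)) j = 0 /\
    zb (mkpoint (za p) (zb p) (tau p + r ^ 2)) j = 0) by (intros; simpl; auto).
  exists (exist _ _ Hq). unfold sphere, hd. simpl.
  set (q := mkpoint _ _ _). destruct (hdist_raw_spec q p) as [H0 H1].
  eapply on_sphere_unique; [assumption|lra|exact H1|].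
  unfold on_sphere.
  assert (Hre : re (mul q (hinv p)) (mul q (hinv p)) = 0).
  { rewrite re_mul_l, !re_mul_r, !re_inv_l, !re_inv_r.
    change (re p q) with (re p p). change (re q q) with (re p p).
    change (re q p) with (re p p). ring. }
  rewrite Hre. split; [nra|]. simpl tau. rewrite im_inv_r. change (im q p) with (im p p).
  rewrite im_self. ring.
Qed.

(** Doubling [t] leaves room above the infimum, so a point of the sphere is found without proving
    that the infimum is attained. *)
Lemma thick_sphere_witness t r (p y : Hn n) : 1 <= t -> 0 < r ->
  thick_sphere n t r p y ->
  exists q : point, on_sphere r (mul q (hinv (proj1_sig p))) /\
    in_box (2 * t) (mul (proj1_sig y) (hinv q)).
Proof.
  intros Ht Hr H. unfold thick_sphere, dist_to_set in H.
  set (S := fun s => exists q, sphere n r p q /\ s = hd n y q) in *.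
  assert (HS : is_glb S (Rinf S)).
  { apply (is_glb_Rinf S 0).
    - destruct (sphere_inhabited r p Hr) as [q Hq]. exists (hd n y q), q. auto.
    - intros s [q [_ ->]]. apply hdist_raw_spec. }
  destruct (Classical_Prop.classic (exists s, S s /\ s < 2 * t)) as [[s [[q [Hq Hs]] Hlt]]|C].
  - exists (proj1_sig q). split.
    + unfold sphere, hd in Hq. destruct (hdist_raw_spec (proj1_sig q) (proj1_sig p)) as [_ H1].
      now rewrite Hq in H1.
    + destruct (hdist_raw_spec (proj1_sig y) (proj1_sig q)) as [H1 H2].
      unfold hd in Hs. rewrite <- Hs in H1, H2.
      apply on_sphere_box in H2; [|assumption].
      destruct H2 as [H2 H3]. split; [lra|nra].
  - exfalso. destruct HS as [_ HS].
    assert (2 * t <= Rinf S); [|lra].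
    apply HS. intros x Hx. apply Rnot_lt_le. intros Hlt. apply C. eauto.
Qed.

(** * Two points on a common sphere *)

Lemma hnorm_ext p q :
  (forall j, za p j = za q j) -> (forall j, zb p j = zb q j) -> nm p = nm q.
Proof.
  intros H1 H2. unfold hnorm; f_equal. apply rsum_ext; intros. now rewrite H1, H2.
Qed.

(** The two sphere equations share the terms in [P] alone; subtracting them and dividing by r^3 rho
    leaves an identity in the rescaled points. *)
Lemma sphere_pair_identity r rho P Q :
  0 < r -> 0 < rho -> on_sphere r P -> on_sphere r (mul Q (hinv P)) ->
  let p := dil (/ r) P in let q := dil (/ rho) Q in let s := rho / r in
  2 * re p q - tau p * im q p + 2 * s * tau p * tau q
  = s * re q q + s * (s * tau q - im q p / 2) ^ 2.
Proof.
  intros Hr Hrho [_ H1] [_ H2] p q s. subst p q s.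
  rewrite !re_dil_l, !re_dil_r, !im_dil_l, !im_dil_r.
  rewrite !re_mul_l, !re_mul_r, !re_inv_l, !re_inv_r, (re_sym Q P) in H2.
  change (tau (mul Q (hinv P))) with (tau Q + - tau P + / 2 * im Q (hinv P)) in H2.
  rewrite im_inv_r in H2.
  change (tau (dil (/ r) P)) with ((/ r) ^ 2 * tau P).
  change (tau (dil (/ rho) Q)) with ((/ rho) ^ 2 * tau Q).
  set (PP := re P P) in *. set (QQ := re Q Q) in *. set (PQ := re P Q) in *.
  set (w := im Q P) in *. set (T := tau P) in *. set (S := tau Q) in *.
  assert (E : 2 * r ^ 2 * PQ + 2 * T * (S - w / 2) = r ^ 2 * QQ + (S - w / 2) ^ 2) by lra.
  transitivity ((2 * r ^ 2 * PQ + 2 * T * (S - w / 2)) / (r ^ 3 * rho)); [field; lra|].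
  rewrite E. field; lra.
Qed.

Lemma on_sphere_normalized r P : 0 < r -> on_sphere r P ->
  nm (dil (/ r) P) * nm (dil (/ r) P) + tau (dil (/ r) P) ^ 2 = 1.
Proof.
  intros Hr [_ H]. rewrite <- hnorm_sq, re_dil_l, re_dil_r.
  change (tau (dil (/ r) P)) with ((/ r) ^ 2 * tau P).
  transitivity ((re P P * r ^ 2 + tau P ^ 2) / r ^ 4); [field; lra|].
  rewrite H. field; lra.
Qed.

(* If q is nearly p, the identity of [sphere_pair_identity] can only hold near the vertical axis. *)
Lemma near_pole_estimate (a T S s w pq qq : R) :
  0 <= a -> 0 < s <= 11 / 10 -> a * a + T ^ 2 = 1 ->
  Rabs (S - T) <= 1 / 1000 -> Rabs w <= 1 / 1000 * a ->
  qq <= (a + 1 / 1000) * (a + 1 / 1000) -> a * a - 1 / 1000 * a <= pq ->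
  2 * pq - T * w + 2 * s * T * S = s * qq + s * (s * S - w / 2) ^ 2 ->
  2 * pq - T * w <= - (7 / 10) * s.
Proof.
  intros Ha Hs HT HS Hw Hqq Hpq E.
  apply Rabs_le_inv in HS. apply Rabs_le_inv in Hw.
  assert (Ha1 : a <= 1) by nra.
  assert (HT1 : -1 <= T <= 1) by nra.
  set (d := S - T) in *. assert (HSd : S = T + d) by (unfold d; ring).
  set (v := s * d - w / 2).
  assert (Hv : - (2 / 1000) <= v <= 2 / 1000) by (unfold v; clear - HS Hw Hs Ha1 Ha; nra).
  assert (Hv2 : (s * S - w / 2) ^ 2 = s * s * T ^ 2 + 2 * s * T * v + v * v).
  { rewrite HSd. unfold v. ring. }
  assert (HsT : - (11 / 10) <= s * T <= 11 / 10) by nra.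
  assert (Hsv : 2 * s * T * v <= 44 / 10000) by nra.
  assert (Hvv : v * v <= 4 / 1000000) by nra.
  assert (Hss : s * s * T ^ 2 <= 121 / 100 * T ^ 2) by (apply Rmult_le_compat_r; nra).
  assert (HTS : T ^ 2 - 1 / 1000 <= T * S) by (rewrite HSd; nra).
  assert (Hq : qq <= a * a + 3 / 1000) by nra.
  (* With [T ^ 2 = 1 - a * a], the bracket is at most a^2 - 0.79 (1 - a^2), up to errors below
     0.01. *)
  assert (Hup : 2 * pq - T * w <= s * (179 / 100 * (a * a) - 78 / 100)).
  { rewrite Hv2 in E.
    assert (s * (qq + (s * s * T ^ 2 + 2 * s * T * v + v * v) - 2 * (T * S))
            <= s * (179 / 100 * (a * a) - 78 / 100)); [|lra].
    apply Rmult_le_compat_l; lra. }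
  assert (Hlow : 2 * (a * a) - 3 / 1000 * a <= 2 * pq - T * w) by nra.
  (* Since 1.1 * 1.79 < 2, the upper bound contradicts the lower one unless [a] is small; this is
     where the ratio bound on [s] is decisive. *)
  assert (Hasmall : a <= 2 / 10).
  { apply Rnot_lt_le. intros C.
    assert (Haa : 2 / 10 * a < a * a <= 1) by (clear - C Ha1; nra).
    assert (s * (179 / 100 * (a * a) - 78 / 100) <= 197 / 100 * (a * a)).
    { clear - Hs Haa C. nra. }
    lra. }
  assert (Haa : a * a <= 4 / 100) by (clear - Ha Hasmall; nra).
  assert (s * (179 / 100 * (a * a) - 78 / 100) <= s * (- (7 / 10)));
    [apply Rmult_le_compat_l|]; lra.
Qed.

(** The height changes by at most 4 t^2 + 1.2 r t, which is negligible against r^2. *)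
Lemma tau_mul_inv_close r t X F :
  0 < r -> 0 <= t <= r / 100000 -> nm X <= 12 / 10 * r -> in_box (2 * t) F ->
  Rabs (tau (dil (/ r) (mul X (hinv F))) - tau (dil (/ r) X)) <= 1 / 10000.
Proof.
  intros Hr Ht HX [HF1 HF2].
  pose proof (im_abs_le X F) as Him. pose proof (hnorm_nonneg X). pose proof (hnorm_nonneg F).
  assert (HXF : nm X * nm F <= (12 / 10 * r) * (2 * t)) by (apply Rmult_le_compat; lra).
  apply Rabs_le_inv in HF2.
  assert (Hi : - (12 / 10 * r * (2 * t)) <= im X F <= 12 / 10 * r * (2 * t)).
  { apply Rabs_le_inv. lra. }
  assert (Ht2 : t * t <= r * r / 1000000) by nra.
  assert (Hrt : r * t <= r * r / 100000) by nra.
  change (tau (dil (/ r) (mul X (hinv F))))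
    with ((/ r) ^ 2 * (tau X + - tau F + / 2 * im X (hinv F))).
  change (tau (dil (/ r) X)) with ((/ r) ^ 2 * tau X). rewrite im_inv_r.
  replace ((/ r) ^ 2 * (tau X + - tau F + / 2 * - im X F) - (/ r) ^ 2 * tau X)
    with ((- tau F - im X F / 2) / (r * r)) by (field; lra).
  assert (0 < r * r) by nra.
  apply Rabs_le. split.
  - apply (Rmult_le_reg_r (r * r)); [assumption|].
    replace ((- tau F - im X F / 2) / (r * r) * (r * r)) with (- tau F - im X F / 2)
      by (field; lra). nra.
  - apply (Rmult_le_reg_r (r * r)); [assumption|].
    replace ((- tau F - im X F / 2) / (r * r) * (r * r)) with (- tau F - im X F / 2)
      by (field; lra). nra.
Qed.

Lemma tau_mul_close r t e X :
  0 < r -> 0 <= t <= r / 100000 -> nm X <= 12 / 10 * r -> in_box (2 * t) e ->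
  Rabs (tau (dil (/ r) (mul e X)) - tau (dil (/ r) X)) <= 1 / 10000.
Proof.
  intros Hr Ht HX He.
  (* Inversion exchanges left and right multiplication, reducing the claim to the previous lemma. *)
  assert (E : mul e X = hinv (mul (hinv X) (hinv e))).
  { apply point_ext; intros; simpl; try ring.
    rewrite im_inv_l, im_inv_r, (im_antisym X e). ring. }
  pose proof (tau_mul_inv_close r t (hinv X) e Hr Ht) as H.
  rewrite hnorm_inv in H. specialize (H HX He).
  rewrite E. rewrite Rabs_minus_sym in H.
  replace (tau (dil (/ r) (hinv (mul (hinv X) (hinv e)))) - tau (dil (/ r) X))
    with (tau (dil (/ r) (hinv X)) - tau (dil (/ r) (mul (hinv X) (hinv e)))); [exact H|].
  unfold dil, hinv; simpl. ring.
Qed.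

(** For unit vectors u, v at distance at most 1/10, |u - v|^2 = 2 - 2 Re<v,u> makes the real part
    nearly 1, while Im<u,v> = Im<u-v,v> is at most 1/10 in size. *)
Lemma direction_positive T X Y :
  -1 <= T <= 1 ->
  nm (mul (dil (/ nm X) X) (hinv (dil (/ nm Y) Y))) <= 1 / 10 ->
  nm X * nm Y <= 2 * re Y X - T * im X Y.
Proof.
  intros HT H.
  pose proof (hnorm_nonneg X) as HX. pose proof (hnorm_nonneg Y) as HY.
  pose proof (re_abs_le Y X) as Hre. pose proof (im_abs_le X Y) as Him.
  destruct (Req_dec (nm X * nm Y) 0) as [E|E].
  - rewrite (Rmult_comm (nm Y)), E in Hre. rewrite E in Him |- *.
    apply Rabs_le_inv in Hre. apply Rabs_le_inv in Him.
    replace (re Y X) with 0 by lra. replace (im X Y) with 0 by lra. lra.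
  - assert (HX0 : 0 < nm X) by (destruct HX as [|HX]; [assumption|rewrite <- HX in E; lra]).
    assert (HY0 : 0 < nm Y) by (destruct HY as [|HY]; [assumption|rewrite <- HY in E; lra]).
    set (u := dil (/ nm X) X) in *. set (v := dil (/ nm Y) Y) in *.
    assert (Hu : re u u = 1).
    { unfold u. rewrite re_dil_l, re_dil_r, hnorm_sq. field. lra. }
    assert (Hv : re v v = 1).
    { unfold v. rewrite re_dil_l, re_dil_r, hnorm_sq. field. lra. }
    set (d := mul u (hinv v)) in *.
    assert (Hd : re d d = 2 - 2 * re v u).
    { unfold d. rewrite re_mul_l, !re_mul_r, !re_inv_l, !re_inv_r, (re_sym u v), Hu, Hv. ring. }
    pose proof (hnorm_nonneg d) as Hd0. rewrite hnorm_sq in Hd.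
    assert (Hdv : im d v = im u v).
    { unfold d. rewrite im_mul_l, im_inv_l, im_self. ring. }
    pose proof (im_abs_le d v) as Hi. rewrite Hdv in Hi.
    assert (Hv1 : nm v = 1).
    { unfold hnorm. rewrite Hv. apply sqrt_1. }
    rewrite Hv1 in Hi. apply Rabs_le_inv in Hi.
    assert (Hmain : 1 <= 2 * re v u - T * im u v) by nra.
    replace (re Y X) with (nm X * nm Y * re v u)
      by (unfold u, v; rewrite re_dil_l, re_dil_r; field; lra).
    replace (im X Y) with (nm X * nm Y * im u v)
      by (unfold u, v; rewrite im_dil_l, im_dil_r; field; lra).
    assert (0 < nm X * nm Y) by nra. nra.
Qed.

Lemma hnorm_base r t X F :
  0 < r -> 0 <= t <= r / 100000 -> on_sphere r (mul X (hinv F)) -> in_box (2 * t) F ->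
  nm X <= 11 / 10 * r.
Proof.
  intros Hr Ht H [HF _]. apply on_sphere_box in H; [|lra]. destruct H as [H _].
  pose proof (hnorm_mul (mul X (hinv F)) F) as H1. rewrite hmul_inv_mul in H1. lra.
Qed.

Lemma hnorm_dil_inv r X c : 0 < r -> nm X <= c * r -> nm (dil (/ r) X) <= c.
Proof.
  intros Hr H. pose proof (Rinv_0_lt_compat r Hr). rewrite hnorm_dil by lra.
  apply (Rmult_le_reg_l r); [assumption|]. rewrite <- Rmult_assoc, Rinv_r by lra. lra.
Qed.

(* [F] and [e] are the corrections that move the base point and [Xi] onto the sphere about [Xj]. *)
Lemma radius_growth r rho t ti Xj Xi F e Fi :
  0 < r -> 0 < rho -> 0 <= t <= rho / 100000 -> 0 <= ti <= rho / 100000 ->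
  on_sphere r (mul Xj (hinv F)) -> on_sphere r (mul (mul e Xi) (hinv Xj)) ->
  in_box (2 * t) F -> in_box (2 * t) e ->
  on_sphere rho (mul Xi (hinv Fi)) -> in_box (2 * ti) Fi ->
  rho <= 5 * r.
Proof.
  intros Hr Hrho Ht Hti HP HQ HF He HPi HFi.
  pose proof (hnorm_base rho ti Xi Fi Hrho Hti HPi HFi) as HXi.
  apply Rnot_lt_le. intros C.
  set (P := mul Xj (hinv F)) in *. set (Q := mul (mul e Xi) (hinv F)).
  (* Right translation by [F]^-1 puts [P] and [Q P^-1] on the same sphere of radius [r] about the
     identity. *)
  assert (HQP : mul Q (hinv P) = mul (mul e Xi) (hinv Xj)) by apply hmul_cancel.
  rewrite <- HQP in HQ.
  apply on_sphere_box in HP; [|lra]. apply on_sphere_box in HQ; [|lra].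
  destruct HP as [HP1 HP2]. destruct HQ as [HQ1 HQ2].
  assert (EQ : Q = mul (mul Q (hinv P)) P) by (symmetry; apply hmul_inv_mul).
  set (G := mul Q (hinv P)) in *.
  (* [Q] is a product of two points of size [r]; if rho > 5 r, it is small at scale [rho]. *)
  assert (HnQ : nm Q <= 2 * r) by (rewrite EQ; pose proof (hnorm_mul G P); lra).
  assert (HtQ : Rabs (tau Q) <= 3 * r ^ 2).
  { rewrite EQ. change (tau (mul G P)) with (tau G + tau P + / 2 * im G P).
    pose proof (im_abs_le G P) as Hi. pose proof (hnorm_nonneg G). pose proof (hnorm_nonneg P).
    assert (nm G * nm P <= r * r) by (apply Rmult_le_compat; lra).
    apply Rabs_le_inv in HP2. apply Rabs_le_inv in HQ2.
    assert (Rabs (im G P) <= r * r) as Hi2 by lra. apply Rabs_le_inv in Hi2.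
    apply Rabs_le. nra. }
  destruct HF as [HF1 HF2]. destruct He as [He1 He2]. destruct HFi as [HFi1 HFi2].
  assert (HnX : nm Xi <= 41 / 100 * rho).
  { replace (nm Xi) with (nm (mul (mul Q F) (hinv e))).
    - pose proof (hnorm_mul (mul Q F) (hinv e)) as H1. rewrite hnorm_inv in H1.
      pose proof (hnorm_mul Q F). lra.
    (* Horizontal parts add, so the order of the factors does not matter. *)
    - apply hnorm_ext; intros; unfold Q; simpl; ring. }
  assert (HeX : nm (mul e Xi) <= 12 / 10 * rho) by (pose proof (hnorm_mul e Xi); lra).
  pose proof (tau_mul_inv_close rho t (mul e Xi) F Hrho Ht HeX (conj HF1 HF2)) as T1.
  pose proof (tau_mul_close rho t e Xi Hrho Ht ltac:(lra) (conj He1 He2)) as T2.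
  pose proof (tau_mul_inv_close rho ti Xi Fi Hrho Hti ltac:(lra) (conj HFi1 HFi2)) as T3.
  pose proof (on_sphere_normalized rho _ Hrho HPi) as HU.
  set (Pi := mul Xi (hinv Fi)) in *.
  assert (HnPi : nm (dil (/ rho) Pi) <= 42 / 100).
  { apply hnorm_dil_inv; [assumption|]. pose proof (hnorm_mul Xi (hinv Fi)) as H1.
    rewrite hnorm_inv in H1. unfold Pi. lra. }
  pose proof (hnorm_nonneg (dil (/ rho) Pi)).
  fold Q in T1. change (tau (dil (/ rho) Q)) with ((/ rho) ^ 2 * tau Q) in T1.
  assert (HtQ' : Rabs ((/ rho) ^ 2 * tau Q) <= 12 / 100).
  { pose proof (Rinv_0_lt_compat rho Hrho) as Hi.
    assert (rho * / rho = 1) as Hii by (field; lra).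
    assert (r * / rho <= 1 / 5) by nra.
    assert (0 < r * / rho) by (apply Rmult_lt_0_compat; lra).
    rewrite Rabs_mult, (Rabs_pos_eq ((/ rho) ^ 2)) by nra.
    apply Rle_trans with ((/ rho) ^ 2 * (3 * r ^ 2)); [apply Rmult_le_compat_l; nra|].
    replace ((/ rho) ^ 2 * (3 * r ^ 2)) with (3 * ((r * / rho) * (r * / rho))) by ring. nra. }
  apply Rabs_le_inv in T1. apply Rabs_le_inv in T2. apply Rabs_le_inv in T3.
  apply Rabs_le_inv in HtQ'.
  (* So the normalized [Pi] has horizontal norm at most 0.42 and height at most 0.2, too small for
     the unit sphere. *)
  assert (-(2/10) <= tau (dil (/ rho) Pi) <= 2/10) by lra. nra.
Qed.

(** The form 2 Re<p,q> - tau(p) Im<q,p> is at most -0.7 s by [near_pole_estimate]. Expanded around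
    the uncorrected points, its main term is at least |zi| |zj| because the directions agree, so the
    correction terms must outweigh both quantities; each conclusion keeps one of them. *)
Lemma pair_estimate r rho t Xj Xi F e :
  0 < r -> 0 < rho -> rho <= 11 / 10 * r ->
  0 <= t <= rho / 100000 -> t <= r / 100000 ->
  on_sphere r (mul Xj (hinv F)) -> on_sphere r (mul (mul e Xi) (hinv Xj)) ->
  in_box (2 * t) F -> in_box (2 * t) e -> nm Xi <= 11 / 10 * rho ->
  nm (mul (dil (/ rho) Xi) (hinv (dil (/ r) Xj))) <= 1 / 2000 ->
  Rabs (tau (dil (/ rho) Xi) - tau (dil (/ r) Xj)) <= 1 / 2000 ->
  nm (mul (dil (/ nm Xi) Xi) (hinv (dil (/ nm Xj) Xj))) <= 1 / 10 ->
  nm Xi <= 12 * t /\ rho * rho <= 24 * nm Xj * t.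
Proof.
  intros Hr Hrho Hs Ht Htr HP HQ HF He HXi Hclose Htau Hdir.
  pose proof (hnorm_base r t Xj F Hr ltac:(lra) HP HF) as HXj.
  set (P := mul Xj (hinv F)) in *. set (Q := mul (mul e Xi) (hinv F)).
  assert (HQP : mul Q (hinv P) = mul (mul e Xi) (hinv Xj)) by apply hmul_cancel.
  rewrite <- HQP in HQ.
  pose proof (sphere_pair_identity r rho P Q Hr Hrho HP HQ) as E. cbv zeta in E.
  pose proof (on_sphere_normalized r P Hr HP) as HU.
  pose proof (Rinv_0_lt_compat r Hr) as Hir. pose proof (Rinv_0_lt_compat rho Hrho) as Hirho.
  assert (HeX : nm (mul e Xi) <= 12 / 10 * rho).
  { destruct He as [He _]. pose proof (hnorm_mul e Xi). lra. }
  pose proof (tau_mul_inv_close rho t (mul e Xi) F Hrho Ht HeX HF) as T1.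
  pose proof (tau_mul_close rho t e Xi Hrho Ht ltac:(lra) He) as T2.
  pose proof (tau_mul_inv_close r t Xj F Hr ltac:(lra) ltac:(lra) HF) as T3.
  fold Q in T1. fold P in T3.
  destruct HF as [HF _]. destruct He as [He _].
  set (p := dil (/ r) P) in *. set (q := dil (/ rho) Q) in *.
  (* Horizontally [p] is [zj + k] and [q] is [zi + h]. *)
  set (k := dil (/ r) (hinv F)). set (h := dil (/ rho) (mul e (hinv F))).
  set (zi := dil (/ rho) Xi) in *. set (zj := dil (/ r) Xj) in *.
  set (s := rho / r) in *. set (c := t / rho).
  assert (Hs0 : 0 < s <= 11 / 10).
  { split; [apply Rdiv_lt_0_compat; assumption|].
    apply (Rmult_le_reg_r r); [assumption|]. unfold s. replace (rho / r * r) with rho by (field; lra). lra. }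
  assert (Hc : 0 <= c <= 1 / 100000).
  { unfold c. split; [apply Rmult_le_pos; lra|].
    apply (Rmult_le_reg_r rho); [assumption|]. replace (t / rho * rho) with t by (field; lra). lra. }
  assert (Hk : nm k <= 2 * (s * c)).
  { unfold k. rewrite hnorm_dil, hnorm_inv by lra.
    replace (2 * (s * c)) with (/ r * (2 * t)) by (unfold s, c; field; lra).
    apply Rmult_le_compat_l; lra. }
  assert (Hh : nm h <= 4 * c).
  { unfold h. rewrite hnorm_dil by lra.
    replace (4 * c) with (/ rho * (4 * t)) by (unfold c; field; lra).
    apply Rmult_le_compat_l; [lra|].
    pose proof (hnorm_mul e (hinv F)) as H1. rewrite hnorm_inv in H1. lra. }
  assert (Hsc : 0 <= s * c <= 11 / 1000000) by nra.
  assert (Hd : nm (mul q (hinv p)) <= 1 / 1000).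
  { replace (nm (mul q (hinv p))) with (nm (mul (mul h (mul zi (hinv zj))) (hinv k))).
    - pose proof (hnorm_mul (mul h (mul zi (hinv zj))) (hinv k)) as H1. rewrite hnorm_inv in H1.
      pose proof (hnorm_mul h (mul zi (hinv zj))). lra.
    - apply hnorm_ext; intros; simpl; ring. }
  set (d := mul q (hinv p)) in *.
  pose proof (hnorm_nonneg p) as Hp0. pose proof (hnorm_nonneg d) as Hd0.
  pose proof (hnorm_nonneg q) as Hq0.
  assert (HT : -1 <= tau p <= 1) by (clear - HU; nra).
  assert (HB : 2 * re p q - tau p * im q p <= - (7 / 10) * s).
  { apply (near_pole_estimate (nm p) (tau p) (tau q) s (im q p) (re p q) (re q q)); try assumption.
    - apply Rabs_le_inv in T1. apply Rabs_le_inv in T2. apply Rabs_le_inv in T3.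
      apply Rabs_le_inv in Htau. apply Rabs_le. lra.
    - replace (im q p) with (im d p)
        by (unfold d; rewrite im_mul_l, im_inv_l, im_self; ring).
      pose proof (im_abs_le d p). nra.
    - rewrite hnorm_sq. assert (nm q <= nm p + 1 / 1000); [|nra].
      rewrite <- (hmul_inv_mul q p). pose proof (hnorm_mul (mul q (hinv p)) p).
      fold d in H |- *. lra.
    - replace (re p q) with (re p p + re p d)
        by (unfold d; rewrite re_mul_r, re_inv_r; ring).
      rewrite hnorm_sq. pose proof (re_abs_le p d) as H1. apply Rabs_le_inv in H1. nra. }
  assert (Hexp : 2 * re p q - tau p * im q p =
    (2 * re zj zi - tau p * im zi zj) + (2 * re k zi - tau p * im zi k)
    + (2 * re p h - tau p * im h p)).
  { assert (E1 : re p q = re zj zi + re k zi + re p h).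
    { unfold p, q, zi, zj, k, h, P, Q.
      rewrite ?re_dil_l, ?re_dil_r, ?re_mul_l, ?re_mul_r, ?re_inv_l, ?re_inv_r. ring. }
    assert (E2 : im q p = im zi zj + im zi k + im h p).
    { unfold p, q, zi, zj, k, h, P, Q.
      rewrite ?im_dil_l, ?im_dil_r, ?im_mul_l, ?im_mul_r, ?im_inv_l, ?im_inv_r. ring. }
    rewrite E1, E2. ring. }
  (* The constant 3 is 2 plus the bound 1 for the height of [p]. *)
  assert (Hgen : forall u v, - (3 * (nm u * nm v)) <= 2 * re u v - tau p * im v u).
  { intros u v. pose proof (re_abs_le u v) as H1. pose proof (im_abs_le v u) as H2.
    rewrite (Rmult_comm (nm v)) in H2. apply Rabs_le_inv in H1. apply Rabs_le_inv in H2.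
    set (N := nm u * nm v) in *. set (w := im v u) in *.
    assert (tau p * w <= N) by (clear - HT H2; nra). lra. }
  pose proof (Hgen k zi) as G1. pose proof (Hgen p h) as G2.
  pose proof (direction_positive (tau p) Xi Xj HT Hdir) as Hpos.
  assert (Hzz : nm zi * nm zj <= 2 * re zj zi - tau p * im zi zj).
  { unfold zi, zj. rewrite !hnorm_dil, re_dil_l, re_dil_r, im_dil_l, im_dil_r by lra.
    assert (0 < / rho * / r) by (apply Rmult_lt_0_compat; assumption).
    clear - H Hpos. nra. }
  pose proof (hnorm_nonneg zi) as Hzi0. pose proof (hnorm_nonneg zj) as Hzj0.
  pose proof (hnorm_nonneg k) as Hk0. pose proof (hnorm_nonneg h) as Hh0.
  assert (Hzi : nm zi <= 11 / 10) by (apply hnorm_dil_inv; assumption).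
  assert (Hp : nm p <= nm zj + 2 * (s * c)).
  { replace (nm p) with (nm (mul zj k)); [pose proof (hnorm_mul zj k); lra|].
    apply hnorm_ext; intros; simpl; ring. }
  assert (Hk1 : nm k * nm zi <= 2 * (s * c) * (11 / 10)) by (apply Rmult_le_compat; lra).
  assert (Hph : nm p * nm h <= (nm zj + 2 * (s * c)) * (4 * c)) by (apply Rmult_le_compat; lra).
  assert (Hsc' : s * c <= s / 100000) by (clear - Hs0 Hc; nra).
  assert (Hscc : s * c * c <= s / 100000) by (clear - Hsc Hsc' Hc; nra).
  (* The errors of order s c and s c^2 are absorbed by lowering 0.7 s to s / 2; only 12 |zj| c
     remains. *)
  assert (Hfin : nm zi * nm zj + s / 2 <= 12 * nm zj * c) by lra.
  assert (Hzj : 0 < nm zj).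
  { apply Rnot_le_lt. intros C. replace (nm zj) with 0 in Hfin by lra. lra. }
  assert (Hzic : nm zi <= 12 * c).
  { apply (Rmult_le_reg_r (nm zj)); lra. }
  assert (Esj : nm zj = nm Xj / r) by (unfold zj; rewrite hnorm_dil by lra; field; lra).
  assert (Esi : nm zi = nm Xi / rho) by (unfold zi; rewrite hnorm_dil by lra; field; lra).
  split.
  - rewrite Esi in Hzic. apply (Rmult_le_compat_r rho) in Hzic; [|lra].
    unfold c in Hzic. replace (nm Xi / rho * rho) with (nm Xi) in Hzic by (field; lra).
    replace (12 * (t / rho) * rho) with (12 * t) in Hzic by (field; lra). assumption.
  - assert (H1 : s <= 24 * nm zj * c).
    { pose proof (Rmult_le_pos _ _ Hzi0 Hzj0). lra. }
    rewrite Esj in H1. unfold s, c in H1.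
    apply (Rmult_le_compat_r (r * rho)) in H1;
      [|apply Rmult_le_pos; lra].
    replace (rho / r * (r * rho)) with (rho * rho) in H1 by (field; lra).
    replace (24 * (nm Xj / r) * (t / rho) * (r * rho)) with (24 * nm Xj * t) in H1 by (field; lra).
    assumption.
Qed.

End Forms.

(** * Pigeonhole for bounded coordinates *)

Lemma filter_length_split {A} (f : A -> bool) (l : list A) :
  (length (filter f l) + length (filter (fun x => negb (f x)) l) = length l)%nat.
Proof. induction l as [|x l IH]; simpl; [reflexivity|]. destruct (f x); simpl; lia. Qed.

Lemma StronglySorted_filter {A} (R : A -> A -> Prop) f l :
  StronglySorted R l -> StronglySorted R (filter f l).
Proof.
  induction 1 as [|x l Hl IH Hx]; simpl; [constructor|].
  destruct (f x); [|assumption]. constructor; [assumption|].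
  apply incl_Forall with l; [apply incl_filter|assumption].
Qed.

Lemma StronglySorted_seq (a k : nat) : StronglySorted lt (seq a k).
Proof.
  revert a. induction k as [|k IH]; intros a; simpl; constructor; [apply IH|].
  apply Forall_forall. intros x Hx. apply in_seq in Hx. lia.
Qed.

(** The interval is cut into [S N] cells of length [delta]. Either the first cell holds more than
    [m] indices, or the others inherit enough of them. Sorted lists stand for subsequences. *)
Lemma pigeonhole_interval (f : nat -> R) (delta : R) (m N : nat) :
  forall a l, StronglySorted lt l -> (S N * m < length l)%nat ->
  (forall i, In i l -> a <= f i <= a + INR (S N) * delta) ->
  exists l', StronglySorted lt l' /\ incl l' l /\ (m < length l')%nat /\
    forall i j, In i l' -> In j l' -> Rabs (f i - f j) <= delta.
Proof.
  induction N as [|N IH]; intros a l Hl Hlen Hf.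
  - exists l. split; [assumption|]. split; [apply incl_refl|]. split; [lia|].
    intros i j Hi Hj. apply Hf in Hi, Hj. simpl in Hi, Hj. apply Rabs_le. lra.
  - set (b := fun i => if Rle_lt_dec (f i) (a + delta) then true else false).
    pose proof (filter_length_split b l) as Hsplit.
    destruct (le_lt_dec (length (filter b l)) m) as [Hle|Hlt].
    + destruct (IH (a + delta) (filter (fun i => negb (b i)) l)) as (l' & H1 & H2 & H3 & H4).
      * now apply StronglySorted_filter.
      * simpl in *. lia.
      * intros i Hi. apply filter_In in Hi. destruct Hi as [Hi Hb].
        unfold b in Hb. destruct (Rle_lt_dec (f i) (a + delta)); [discriminate|].
        apply Hf in Hi. rewrite !S_INR in Hi. rewrite S_INR. lra.
      * exists l'. repeat split; try assumption.
        eapply incl_tran; [exact H2|apply incl_filter].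
    + exists (filter b l). split; [now apply StronglySorted_filter|].
      split; [apply incl_filter|]. split; [assumption|].
      intros i j Hi Hj. apply filter_In in Hi, Hj.
      destruct Hi as [Hi Hbi], Hj as [Hj Hbj]. unfold b in Hbi, Hbj.
      destruct (Rle_lt_dec (f i) (a + delta)); [|discriminate].
      destruct (Rle_lt_dec (f j) (a + delta)); [|discriminate].
      apply Hf in Hi, Hj. apply Rabs_le. lra.
Qed.

(** One function is made nearly constant at a time. [K] is chosen before the functions, so that
    [kappa] can be fixed before the configuration. *)
Lemma pigeonhole_coordinates (D m : nat) (M delta : R) : 0 < delta ->
  exists K : nat, forall (fs : list (nat -> R)) (l : list nat),
    length fs = D -> StronglySorted lt l -> (K < length l)%nat ->
    (forall f i, In f fs -> In i l -> Rabs (f i) <= M) ->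
    exists l', StronglySorted lt l' /\ incl l' l /\ (m < length l')%nat /\
      forall f i j, In f fs -> In i l' -> In j l' -> Rabs (f i - f j) <= delta.
Proof.
  intros Hdelta.
  destruct (INR_unbounded (2 * M / delta)) as [N HN].
  assert (HNM : 2 * M <= INR (S N) * delta).
  { rewrite S_INR. apply (Rmult_lt_compat_r delta) in HN; [|assumption].
    replace (2 * M / delta * delta) with (2 * M) in HN by (field; lra). nra. }
  induction D as [|D [K HK]].
  - exists m. intros fs l Hfs Hl Hlen _. exists l. destruct fs; [|discriminate].
    repeat split; try assumption; [apply incl_refl|intros f i j []].
  - exists (S N * K)%nat. intros fs l Hfs Hl Hlen Hb.
    destruct fs as [|f fs]; [discriminate|]. injection Hfs as Hfs.
    destruct (pigeonhole_interval f delta K N (- M) l Hl Hlen) as (l1 & H1 & H2 & H3 & H4).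
    { intros i Hi. assert (Rabs (f i) <= M) as HM by (apply Hb; [left; reflexivity|assumption]).
      unfold Rabs in HM. destruct (Rcase_abs (f i)); lra. }
    destruct (HK fs l1 Hfs H1 H3) as (l2 & G1 & G2 & G3 & G4).
    { intros g i Hg Hi. apply Hb; [right; assumption|now apply H2]. }
    exists l2. split; [assumption|]. split; [eapply incl_tran; eassumption|].
    split; [assumption|].
    intros g i j [<-|Hg] Hi Hj; [apply H4; now apply G2|now apply G4].
Qed.

(* If r(i) <= 5 r(j) for all j < i, then r / running_min r is bounded, and indices where this
   ratio is nearly constant have nearly decreasing radii. *)
Fixpoint running_min (r : nat -> R) (k : nat) : R :=
  match k with O => r 1%nat | S k' => Rmin (running_min r k') (r (S k')) end.

Lemma running_min_decr r i j : (i <= j)%nat -> running_min r j <= running_min r i.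
Proof.
  induction 1; [lra|]. simpl. pose proof (Rmin_l (running_min r m) (r (S m))). lra.
Qed.

Lemma running_min_le r i : (1 <= i)%nat -> running_min r i <= r i.
Proof. destruct i; [lia|]. intros _. apply Rmin_r. Qed.

Lemma running_min_attained r i : (1 <= i)%nat ->
  exists j, (1 <= j <= i)%nat /\ running_min r i = r j.
Proof.
  induction i as [|i IH]; [lia|]. intros _. simpl.
  destruct (Nat.eq_dec i 0) as [->|Hi].
  (* By convention [running_min r 0] is [r 1], so this is the minimum of [r 1] with itself. *)
  - exists 1%nat. split; [lia|]. simpl. apply Rmin_left. lra.
  - destruct IH as [j [Hj E]]; [lia|]. rewrite E. unfold Rmin.
    destruct (Rle_dec (r j) (r (S i))); [exists j|exists (S i)]; split; try lia; reflexivity.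
Qed.

(** * Products of the thicknesses *)

Lemma rprod1_ge1 (t : nat -> R) (i : nat) :
  (forall k, (1 <= k <= i)%nat -> 1 <= t k) -> 1 <= rprod1 i t.
Proof.
  induction i as [|i IH]; intros H; simpl; [lra|].
  assert (1 <= rprod1 i t) by (apply IH; intros; apply H; lia).
  assert (1 <= t (S i)) by (apply H; lia). nra.
Qed.

Lemma rprod1_ge_factor (t : nat -> R) (i a : nat) :
  (forall k, (1 <= k <= i)%nat -> 1 <= t k) -> (1 <= a <= i)%nat -> t a <= rprod1 i t.
Proof.
  induction i as [|i IH]; intros H Ha; simpl; [lia|].
  assert (1 <= rprod1 i t) by (apply rprod1_ge1; intros; apply H; lia).
  assert (1 <= t (S i)) by (apply H; lia).
  destruct (Nat.eq_dec a (S i)) as [->|Hne]; [nra|].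
  assert (t a <= rprod1 i t) by (apply IH; [intros; apply H; lia|lia]). nra.
Qed.

Lemma rprod1_ge_two_factors (t : nat -> R) (i a b : nat) :
  (forall k, (1 <= k <= i)%nat -> 1 <= t k) -> (1 <= a < b)%nat -> (b <= i)%nat ->
  t a * t b <= rprod1 i t.
Proof.
  induction i as [|i IH]; intros H Hab Hb; simpl; [lia|].
  assert (1 <= rprod1 i t) by (apply rprod1_ge1; intros; apply H; lia).
  assert (1 <= t (S i)) by (apply H; lia).
  destruct (Nat.eq_dec b (S i)) as [->|Hne].
  - assert (t a <= rprod1 i t) by (apply rprod1_ge_factor; [intros; apply H; lia|lia]). nra.
  - assert (t a * t b <= rprod1 i t) by (apply IH; [intros; apply H; lia|lia|lia]). nra.
Qed.

(** * Configurations of thick spheres *)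

Section Configuration.
Variable n : nat.
Notation nm := (hnorm n).
Notation mul := (hmul n).

Lemma coord_le_hnorm p j : (j < n)%nat -> Rabs (za p j) <= nm p /\ Rabs (zb p j) <= nm p.
Proof.
  intros Hj.
  assert (H : za p j ^ 2 + zb p j ^ 2 <= nm p * nm p).
  { rewrite <- hnorm_sq. unfold re_inner. clear - Hj. induction n as [|m IH]; [lia|]. simpl.
    destruct (Nat.eq_dec j m) as [->|Hne].
    - pose proof (rsum_nonneg m (fun j => za p j * za p j + zb p j * zb p j)
        ltac:(intros; nra)). lra.
    - assert (Hjm : (j < m)%nat) by lia. specialize (IH Hjm). nra. }
  pose proof (hnorm_nonneg n p).
  split; (apply Rsqr_incr_0; [rewrite <- Rsqr_abs; unfold Rsqr; nra|apply Rabs_pos|assumption]).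
Qed.

Lemma hnorm_close p q delta eta : 0 <= eta -> INR n * (2 * (delta * delta)) <= eta * eta ->
  (forall j, (j < n)%nat ->
     Rabs (za p j - za q j) <= delta /\ Rabs (zb p j - zb q j) <= delta) ->
  nm (mul p (hinv q)) <= eta.
Proof.
  intros Heta Hd H. apply hnorm_le; [assumption|].
  eapply Rle_trans; [|exact Hd]. apply rsum_le_const. intros j Hj. simpl.
  destruct (H j Hj) as [H1 H2]. apply Rabs_le_inv in H1. apply Rabs_le_inv in H2. nra.
Qed.

Lemma hnorm_unit X : nm (dil (/ nm X) X) <= 1.
Proof.
  pose proof (hnorm_nonneg n X) as HX. destruct HX as [HX|HX].
  - apply hnorm_dil_inv; lra.
  (* Since [/ 0 = 0], a vanishing horizontal part is given direction zero. *)
  - rewrite <- HX, Rinv_0, hnorm_dil by lra. lra.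
Qed.

(** After the translation taking [y] to the identity, the sphere point [q] near [y] becomes
    [F = q y^-1], a right correction of [x y^-1]. *)
Lemma base_correction t r (x y : Hn n) : 1 <= t -> 0 < r -> thick_sphere n t r x y ->
  exists F, on_sphere n r (mul (mul (proj1_sig x) (hinv (proj1_sig y))) (hinv F)) /\
            in_box n (2 * t) F.
Proof.
  intros Ht Hr H. destruct (thick_sphere_witness n t r x y Ht Hr H) as [q [H1 H2]].
  exists (mul q (hinv (proj1_sig y))). rewrite hmul_cancel. split.
  - rewrite <- hinv_mul_inv. now apply on_sphere_inv.
  - rewrite <- hinv_mul_inv. now apply in_box_inv.
Qed.

(** Here the sphere point [q] near [xi] gives [e = q xi^-1], which corrects the translate of [xi] on
    the left. *)
Lemma pair_correction t r (xj xi y : Hn n) : 1 <= t -> 0 < r -> thick_sphere n t r xj xi ->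
  exists e, on_sphere n r (mul (mul e (mul (proj1_sig xi) (hinv (proj1_sig y))))
                               (hinv (mul (proj1_sig xj) (hinv (proj1_sig y))))) /\
            in_box n (2 * t) e.
Proof.
  intros Ht Hr H. destruct (thick_sphere_witness n t r xj xi Ht Hr H) as [q [H1 H2]].
  exists (mul q (hinv (proj1_sig xi))). split.
  - rewrite <- (hmul_cancel n q (proj1_sig y) (proj1_sig xi)), hmul_inv_mul, hmul_cancel. assumption.
  - rewrite <- hinv_mul_inv. now apply in_box_inv.
Qed.

(** The real functions of the index fed to the pigeonhole principle. Directions are listed
    separately, because close rescaled points near the vertical axis may have very different
    directions. *)
Definition coordinates (r : nat -> R) (X : nat -> point) : list (nat -> R) :=
  (fun i => r i / running_min r i) :: (fun i => tau (dil (/ r i) (X i))) ::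
  flat_map (fun j =>
    (fun i => za (dil (/ r i) (X i)) j) :: (fun i => zb (dil (/ r i) (X i)) j) ::
    (fun i => za (dil (/ nm (X i)) (X i)) j) :: (fun i => zb (dil (/ nm (X i)) (X i)) j) :: nil)
    (seq 0 n).

Lemma coordinates_length r X : length (coordinates r X) = (2 + n * 4)%nat.
Proof.
  unfold coordinates. simpl. do 2 f_equal.
  rewrite (flat_map_constant_length (c := 4)); [now rewrite length_seq|reflexivity].
Qed.

Lemma coordinates_bounded r X i :
  0 < running_min r i -> 0 < r i -> running_min r i <= r i <= 5 * running_min r i ->
  nm (X i) <= 11 / 10 * r i -> Rabs (tau (dil (/ r i) (X i))) <= 2 ->
  forall f, In f (coordinates r X) -> Rabs (f i) <= 5.
Proof.
  intros Hm Hr Hmr HX Htau f Hf.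
  assert (Hz : nm (dil (/ r i) (X i)) <= 11 / 10) by now apply hnorm_dil_inv.
  pose proof (hnorm_unit (X i)) as Hu.
  destruct Hf as [<-|[<-|Hf]].
  - assert (E : r i / running_min r i * running_min r i = r i) by (field; lra).
    rewrite Rabs_pos_eq by (apply Rmult_le_pos; [lra|left; now apply Rinv_0_lt_compat]).
    apply (Rmult_le_reg_r (running_min r i)); lra.
  - lra.
  - apply in_flat_map in Hf. destruct Hf as [j [Hj Hf]]. apply in_seq in Hj.
    destruct (coord_le_hnorm (dil (/ r i) (X i)) j ltac:(lia)) as [C1 C2].
    destruct (coord_le_hnorm (dil (/ nm (X i)) (X i)) j ltac:(lia)) as [C3 C4].
    destruct Hf as [<-|[<-|[<-|[<-|[]]]]]; lra.
Qed.

Lemma coordinates_close r X i j delta eta :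
  0 <= eta -> INR n * (2 * (delta * delta)) <= eta * eta ->
  (forall f, In f (coordinates r X) -> Rabs (f i - f j) <= delta) ->
  Rabs (r i / running_min r i - r j / running_min r j) <= delta /\
  Rabs (tau (dil (/ r i) (X i)) - tau (dil (/ r j) (X j))) <= delta /\
  nm (mul (dil (/ r i) (X i)) (hinv (dil (/ r j) (X j)))) <= eta /\
  nm (mul (dil (/ nm (X i)) (X i)) (hinv (dil (/ nm (X j)) (X j)))) <= eta.
Proof.
  intros Heta Hd H.
  assert (Hin : forall k f, (k < n)%nat -> In f
    ((fun i => za (dil (/ r i) (X i)) k) :: (fun i => zb (dil (/ r i) (X i)) k) ::
     (fun i => za (dil (/ nm (X i)) (X i)) k) ::
     (fun i => zb (dil (/ nm (X i)) (X i)) k) :: nil) -> Rabs (f i - f j) <= delta).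
  { intros k f Hk Hf. apply H. right; right. apply in_flat_map. exists k.
    split; [apply in_seq; lia|exact Hf]. }
  split; [|split; [|split]].
  - apply (H (fun i => r i / running_min r i)). left; reflexivity.
  - apply (H (fun i => tau (dil (/ r i) (X i)))). right; left; reflexivity.
  - apply (hnorm_close _ _ delta); try assumption. intros k Hk. split.
    + apply (Hin k (fun i => za (dil (/ r i) (X i)) k) Hk). simpl; tauto.
    + apply (Hin k (fun i => zb (dil (/ r i) (X i)) k) Hk). simpl; tauto.
  - apply (hnorm_close _ _ delta); try assumption. intros k Hk. split.
    + apply (Hin k (fun i => za (dil (/ nm (X i)) (X i)) k) Hk). simpl; tauto.
    + apply (Hin k (fun i => zb (dil (/ nm (X i)) (X i)) k) Hk). simpl; tauto.
Qed.

(** The ratio at [j] is at least 1, so the ratio at [i] is at most 1.1 times it, and the running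
    minimum decreases from [j] to [i]. *)
Lemma ratio_of_close_running_ratio r i j :
  (1 <= j <= i)%nat -> 0 < running_min r i -> 0 < running_min r j ->
  Rabs (r i / running_min r i - r j / running_min r j) <= 1 / 10 ->
  r i <= 11 / 10 * r j.
Proof.
  intros Hji Hmi Hmj H. apply Rabs_le_inv in H.
  pose proof (running_min_decr r j i ltac:(lia)) as Hd.
  pose proof (running_min_le r j ltac:(lia)) as Hl.
  set (a := r i / running_min r i) in *. set (b := r j / running_min r j) in *.
  assert (Ea : r i = a * running_min r i) by (unfold a; field; lra).
  assert (Eb : r j = b * running_min r j) by (unfold b; field; lra).
  assert (Hb : 1 <= b) by (apply (Rmult_le_reg_r (running_min r j)); lra).
  apply Rle_trans with ((b + 1 / 10) * running_min r i); [rewrite Ea; nra|].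
  apply Rle_trans with ((b + 1 / 10) * running_min r j); [nra|]. rewrite Eb. nra.
Qed.

End Configuration.

Theorem theorem14 (n : nat) (hn : (1 <= n)%nat) :
  exists (kappa : nat) (Rb : R), 1 < Rb /\
    forall (t r : nat -> R) (x : nat -> Hn n),
      (forall i, (1 <= i <= kappa)%nat -> 1 <= t i) ->
      (forall i, (1 <= i <= kappa)%nat -> rprod1 i t * Rb <= r i) ->
      (forall i j, (1 <= j)%nat -> (j < i)%nat -> (i <= kappa)%nat ->
         thick_sphere n (t j) (r j) (x j) (x i)) ->
      ~ (exists y : Hn n, forall i, (1 <= i <= kappa)%nat ->
           thick_sphere n (t i) (r i) (x i) y).
Proof.
  (* [eta] is the closeness that [pair_estimate] asks for; [delta] is small enough for [2 n]
     coordinates to give it in norm. *)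
  set (eta := 1 / 2000). set (delta := eta / (2 * INR (S n))).
  assert (HSn : 1 <= INR (S n)) by (rewrite S_INR; pose proof (pos_INR n); lra).
  assert (Edelta : delta * (2 * INR (S n)) = eta) by (unfold delta; field; lra).
  assert (Hdelta : 0 < delta).
  { unfold delta, eta. apply Rdiv_lt_0_compat; lra. }
  assert (Hdelta1 : delta <= 1 / 2000) by (unfold eta in Edelta; nra).
  assert (Hdn : INR n * (2 * (delta * delta)) <= eta * eta).
  { rewrite <- Edelta. rewrite S_INR in *. pose proof (pos_INR n).
    assert (0 < delta * delta) by nra. set (dd := delta * delta) in *.
    replace (delta * (2 * (INR n + 1)) * (delta * (2 * (INR n + 1))))
      with (dd * (4 * (INR n + 1) * (INR n + 1))) by (unfold dd; ring). nra. }
  (* The aim is more than 2 surviving indices. The bound 5 comes from [radius_growth]. *)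
  destruct (pigeonhole_coordinates (2 + n * 4) 2 5 delta Hdelta) as [K HK].
  (* This radius factor yields the bounds t <= r / 100000 required by all the estimates. *)
  exists (S K), 100000. split; [lra|].
  intros t r x Ht Hr Hx [y Hy].
  set (X := fun i => hmul n (proj1_sig (x i)) (hinv (proj1_sig y))).
  assert (Hrt : forall i j, (1 <= j <= i)%nat -> (i <= S K)%nat -> 0 <= t j <= r i / 100000).
  { intros i j Hj Hi. pose proof (Hr i ltac:(lia)). pose proof (Ht j ltac:(lia)).
    pose proof (rprod1_ge_factor t i j ltac:(intros; apply Ht; lia) ltac:(lia)). lra. }
  assert (Hr1 : forall i, (1 <= i <= S K)%nat -> 100000 <= r i).
  { intros i Hi. pose proof (Hrt i i ltac:(lia) ltac:(lia)). pose proof (Ht i Hi). lra. }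
  assert (HF : forall i, (1 <= i <= S K)%nat -> exists F,
    on_sphere n (r i) (hmul n (X i) (hinv F)) /\ in_box n (2 * t i) F).
  { intros i Hi. pose proof (Hr1 i Hi). apply base_correction; [now apply Ht|lra|now apply Hy]. }
  assert (He : forall i j, (1 <= j < i)%nat -> (i <= S K)%nat -> exists e,
    on_sphere n (r j) (hmul n (hmul n e (X i)) (hinv (X j))) /\ in_box n (2 * t j) e).
  { intros i j Hj Hi. pose proof (Hr1 j ltac:(lia)).
    apply pair_correction; [apply Ht; lia|lra|apply Hx; lia]. }
  assert (Hgrow : forall i j, (1 <= j <= i)%nat -> (i <= S K)%nat -> r i <= 5 * r j).
  { intros i j Hj Hi. pose proof (Hr1 j ltac:(lia)). pose proof (Hr1 i ltac:(lia)).
    destruct (Nat.eq_dec j i) as [->|Hne]; [lra|].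
    destruct (HF j ltac:(lia)) as [F [HF1 HF2]]. destruct (HF i ltac:(lia)) as [Fi [HFi1 HFi2]].
    destruct (He i j ltac:(lia) Hi) as [e [He1 He2]].
    apply (radius_growth n (r j) (r i) (t j) (t i) (X j) (X i) F e Fi);
      try assumption; try lra; apply Hrt; lia. }
  assert (HXn : forall i, (1 <= i <= S K)%nat -> hnorm n (X i) <= 11 / 10 * r i).
  { intros i Hi. destruct (HF i Hi) as [F [HF1 HF2]]. pose proof (Hr1 i Hi).
    apply (hnorm_base n (r i) (t i) (X i) F); [lra|apply Hrt; lia|assumption|assumption]. }
  assert (Hmin : forall i, (1 <= i <= S K)%nat ->
    0 < running_min r i /\ running_min r i <= r i <= 5 * running_min r i).
  { intros i Hi. pose proof (running_min_le r i ltac:(lia)).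
    destruct (running_min_attained r i ltac:(lia)) as [j [Hj E]].
    pose proof (Hr1 j ltac:(lia)). pose proof (Hgrow i j ltac:(lia) ltac:(lia)). lra. }
  destruct (HK (coordinates n r X) (seq 1 (S K))) as (l & Hl1 & Hl2 & Hl3 & Hl4).
  { apply coordinates_length. }
  { apply StronglySorted_seq. }
  { rewrite length_seq. lia. }
  { intros f i Hf Hi. apply in_seq in Hi. assert (Hi' : (1 <= i <= S K)%nat) by lia.
    pose proof (Hmin i Hi'). pose proof (Hr1 i Hi'). pose proof (HXn i Hi').
    apply (coordinates_bounded n r X i); try assumption; try lra.
    destruct (HF i Hi') as [F [HF1 HF2]].
    pose proof (tau_mul_inv_close n (r i) (t i) (X i) F ltac:(lra)
      (Hrt i i ltac:(lia) ltac:(lia)) ltac:(lra) HF2) as HT.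
    pose proof (on_sphere_normalized n (r i) _ ltac:(lra) HF1) as HU.
    set (T := tau (dil (/ r i) (hmul n (X i) (hinv F)))) in *.
    (* A corrected point on the unit sphere has height at most 1, and the correction moves it by at
       most 1/10000. *)
    assert (HT1 : -1 <= T <= 1) by (clear - HU; nra).
    apply Rabs_le_inv in HT. apply Rabs_le. lra. }
  assert (Hpair : forall i j, (j < i)%nat -> In i l -> In j l ->
    hnorm n (X i) <= 12 * t j /\ r i * r i <= 24 * hnorm n (X j) * t j).
  { intros i j Hji Hil Hjl.
    pose proof (Hl2 i Hil) as Hi. pose proof (Hl2 j Hjl) as Hj. apply in_seq in Hi, Hj.
    destruct (coordinates_close n r X i j delta eta) as (C1 & C2 & C3 & C4);
      [unfold eta; lra|assumption|intros f Hf; now apply Hl4|].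
    unfold eta in *.
    pose proof (Hr1 i ltac:(lia)). pose proof (Hr1 j ltac:(lia)).
    destruct (HF j ltac:(lia)) as [F [HF1 HF2]].
    destruct (He i j ltac:(lia) ltac:(lia)) as [e [He1 He2]].
    apply (pair_estimate n (r j) (r i) (t j) (X j) (X i) F e); try assumption; try lra.
    - apply ratio_of_close_running_ratio; [lia|apply Hmin; lia|apply Hmin; lia|lra].
    - apply Hrt; lia.
    - apply Hrt; lia.
    - apply HXn; lia. }
  destruct l as [|a [|b [|c l]]]; simpl in Hl3; try lia.
  inversion Hl1 as [|? ? Hl1b Hab]; subst. inversion Hl1b as [|? ? _ Hbc]; subst.
  apply Forall_inv in Hab as Hab'. apply Forall_inv in Hbc.
  pose proof (Hl2 a ltac:(simpl; tauto)) as Ha. pose proof (Hl2 c ltac:(simpl; tauto)) as Hc.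
  apply in_seq in Ha, Hc.
  (* The middle index serves twice: the first pair bounds |X b| by 12 t(a), and the second bounds
     r(c)^2 by 24 |X b| t(b). *)
  destruct (Hpair b a Hab' ltac:(simpl; tauto) ltac:(simpl; tauto)) as [H1 _].
  destruct (Hpair c b Hbc ltac:(simpl; tauto) ltac:(simpl; tauto)) as [_ H2].
  pose proof (rprod1_ge_two_factors t c a b ltac:(intros; apply Ht; lia) ltac:(lia) ltac:(lia)) as H3.
  pose proof (Hr c ltac:(lia)) as H4. pose proof (Hr1 c ltac:(lia)) as H5.
  pose proof (Ht b ltac:(lia)) as H6.
  assert (H7 : r c * r c <= 288 * (t a * t b)) by (clear - H1 H2 H6; nra).
  (* As t(a) t(b) <= r(c) / 100000, this would give r(c)^2 <= 0.00288 r(c), although r(c) >=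
     100000. *)
  clear - H3 H4 H5 H7. nra.
Qed.
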